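(* Let $C$ be the middle third Cantor set and let $\mu$ be the $\frac{\log 2}{\log 3}$-dimensional Hausdorff measure restricted to $C$. Then for $\mu$-almost every $x$, the dyadic expansion $(a_n)_{n=1}^{\infty}\in\{0,1\}^{\mathbb{N}}$ of $x$ satisfies $$a_{n+1}\ldots a_{n+\lfloor 0.01\log_{2}n\rfloor}=\underbrace{0\ldots 0}_{\lfloor 0.01\log_{2}n\rfloor}$$ for infinitely many $n\in\mathbb{N}$.
   Context: A dyadic expansion of $x\in[0,1]$ is a sequence $(a_n)_{n=1}^\infty\in\{0,1\}^{\mathbb{N}}$ with $x=\sum_{n=1}^{\infty}a_n2^{-n}$; it is unique unless $x$ is a dyadic rational, and the countable set of dyadic rationals has $\mu$-measure zero. The measure $\mu$ is a probability measure and coincides with the self-similar measure on $C$ giving weights $(1/2,1/2)$ to the maps $x\mapsto x/3$ and $x\mapsto (x+2)/3$. *)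

(* Defs.v *)
From HB Require Import structures.
From mathcomp Require Import all_boot all_order all_algebra.
From mathcomp Require Import all_classical all_reals all_analysis.
Set Implicit Arguments.
Unset Strict Implicit.
Unset Printing Implicit Defensive.
Import Order.TTheory GRing.Theory Num.Theory numFieldNormedType.Exports.
Local Open Scope classical_set_scope.
Local Open Scope ring_scope.

(* The point 0 only serves to give the empty set diameter 0, not -oo. *)
Definition diam (R : realType) (U : set R) : \bar R :=
  ereal_sup (0%E |` [set (`|x - y|)%:E | x in U & y in U]).

Definition is_cover (R : realType) (d : R) (A : set R) (U : nat -> set R) :=
  A `<=` \bigcup_i U i /\ forall i, (diam (U i) <= d%:E)%E.

(* Intended for s > 0: then 0 `^ s = 0, so a sequence padded with empty sets
   also represents a finite cover. *)
Definition hausdorff_content (R : realType) (s d : R) (A : set R) : \bar R :=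
  ereal_inf [set (\sum_(0 <= i <oo) poweR (diam (U i)) s)%E
            | U in is_cover d A].

(* No normalizing constant: with this convention the (ln 2 / ln 3)-dimensional
   measure of the Cantor set is 1. *)
Definition hausdorff_measure (R : realType) (s : R) (A : set R) : \bar R :=
  ereal_sup [set hausdorff_content s d A | d in [set d : R | 0 < d]].

Fixpoint cantor_stage {R : realType} (n : nat) : set R :=
  if n is m.+1 then
    [set x / 3 | x in cantor_stage m]
    `|` [set (x + 2) / 3 | x in cantor_stage m]
  else `[0, 1].

Definition cantor_set {R : realType} : set R := \bigcap_n cantor_stage n.

(* The type makes {ae cantor_measure, _} refer to Borel null sets. *)
Definition cantor_measure {R : realType} :
    set (measurableTypeR R) -> \bar R :=
  fun A => hausdorff_measure (ln 2 / ln 3) (A `&` cantor_set).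

(* Digits are indexed from 0: a k is the coefficient of 2^-(k+1), that is,
   the digit usually written a_{k+1}. *)
Definition dyadic_expansion (R : realType) (x : R) (a : nat -> bool) : Prop :=
  series (fun k => (a k)%:R / 2 ^+ k.+1 : R) @ \oo --> x.

Definition log2 (R : realType) (x : R) : R := ln x / ln 2.

Definition run_length (R : realType) (n : nat) : int :=
  Num.floor (100^-1 * log2 (n%:R : R)).

(* For n >= 1, the digits a_{n+1}, ..., a_{n + run_length n} all vanish. *)
Definition zero_run_at (R : realType) (a : nat -> bool) (n : nat) : Prop :=
  forall i : nat, i%:Z < run_length R n -> a (n + i)%N = false.

(* Main.v *)
(* Fix [L] and put [N = 2 * 3 ^ r] with [r = 50 L]. With [w = 2 ^ - L], the
   trigonometric polynomial [cos (pi (y - w / 2)) ^ (2 M)] is at most half of its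
   mean when [y] is, modulo 1, outside the middle half of [(0, w)], provided [M]
   is a suitable power of 4 of order [16 ^ L]. A point [x] whose shifts
   [2 ^ n x], [N <= n < 2 N], all miss [[0, w)] modulo 1 therefore makes the
   centred sum of this polynomial over these shifts very negative, and Chebyshev's
   inequality bounds the proportion of level-[m] Cantor intervals that contain
   such an [x], for all large [m].

   The second moment is a sum of Fourier coefficients of the Cantor measure,
   which are bounded by [prod_j |cos (2 pi t / 3 ^ j)|]. Since 2 is a primitive
   root modulo [3 ^ (r + 1)], along [t 2 ^ n], [n < N], these products run
   through distinct residues modulo [3 ^ (r + 1)]; as
   [|cos x| + |cos (x + 2 pi / 3)| + |cos (x + 4 pi / 3)| <= 2], they add up to
   at most [2 ^ (r + 1)], a power saving over [N]. This beats the powers of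
   [2 ^ L] lost to [M], so the proportion is [O(2 ^ - L)]. Only upper bounds for
   the Hausdorff measure are needed, hence explicit covers suffice. *)
Require Import Defs.
From mathcomp Require Import all_boot all_order all_algebra.
From mathcomp Require Import all_classical all_reals all_analysis.
From mathcomp Require Import zify ring lra.
Set Implicit Arguments.
Unset Strict Implicit.
Unset Printing Implicit Defensive.
Import Order.TTheory GRing.Theory Num.Theory numFieldNormedType.Exports.
Local Open Scope classical_set_scope.

(** * The powers of 2 modulo powers of 3 *)

Lemma exp4_mod3 e : exists s, (4 ^ e = 3 * s + 1)%N.
Proof.
elim: e => [|e [s IH]]; first by exists 0%N.
by exists (4 * s + 1)%N; rewrite expnS IH; lia.
Qed.

(** Lifting the exponent: cubing a number [3 * s + 1] raises the 3-adic valuation of its distance to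
    1 by exactly one, because the cofactor [3 * (s * s + s) + 1] is coprime to 3. *)
Lemma dvdn_pow3_exp4 r e : (3 ^ r.+1 %| 4 ^ e - 1)%N -> (3 ^ r %| e)%N.
Proof.
elim: r e => [|r IH] e; first by rewrite dvd1n.
have e3 : (e = 3 * (e %/ 3) + e %% 3)%N by lia.
move: e3 (ltn_pmod e (isT : 0 < 3)%N); move: (e %/ 3)%N (e %% 3)%N => q d -> d3.
have [s Hs] := exp4_mod3 q; have p3 : (0 < 3 ^ r)%N by rewrite expn_gt0.
have qE : (4 ^ (3 * q) = (3 * s + 1) ^ 3)%N by rewrite mulnC expnM Hs.
rewrite expnD qE => dv.
(* Modulo 9 the cube is 1, while 4 and 16 are not. *)
have d0 : d = 0%N.
  move: dv; rewrite !(expnSr 3) -mulnA => /(dvdn_trans (dvdn_mull _ (dvdnn _))).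
  by case/dvdnP => k; case: d d3 => [|[|[|d]]] //= _; rewrite !expnS expn0; nia.
rewrite d0 addn0 expnS dvdn_pmul2l//; apply: IH.
move: dv; rewrite d0 expn0 muln1 Hs addnK.
have -> : ((3 * s + 1) ^ 3 - 1 = 3 * ((3 * s) * (3 * (s * s + s) + 1)))%N.
  by rewrite !expnS expn0; nia.
rewrite (expnS 3 r.+1) dvdn_pmul2l// Gauss_dvdl//.
by rewrite coprimeXl// /coprime mulnC gcdnMDl.
Qed.

(** An odd power of 2 is 2 modulo 3, so [d] is even and the statement for powers of 4 applies. *)
Lemma dvdn_pow3_exp2 r d : (3 ^ r.+1 %| 2 ^ d - 1)%N -> (2 * 3 ^ r %| d)%N.
Proof.
move=> dv; have d2 : (d = d./2 * 2 + odd d)%N by rewrite muln2 addnC odd_double_half.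
have [s Hs] := exp4_mod3 d./2.
have dE : (2 ^ d = 4 ^ d./2 * 2 ^ odd d)%N.
  by rewrite {1}d2 expnD (mulnC d./2) (expnM 2 2).
move: dv; rewrite dE; move: d2; case: (odd d) => /= d2 dv.
  move: dv; rewrite expnS => /(dvdn_trans (dvdn_mulr _ (dvdnn _))) /dvdnP[k].
  by rewrite Hs expn1; lia.
rewrite d2 addn0 mulnC dvdn_pmul2r//; apply: dvdn_pow3_exp4.
by move: dv; rewrite expn0 muln1.
Qed.

Lemma pow2_mod3_inj r u n n' : coprime 3 u ->
  (n < 2 * 3 ^ r)%N -> (n' < 2 * 3 ^ r)%N ->
  (u * 2 ^ n = u * 2 ^ n' %[mod 3 ^ r.+1])%N -> n = n'.
Proof.
move=> cu; wlog le_nn : n n' / (n <= n')%N.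
  move=> W nr nr' E; have [|/ltnW] := leqP n n' => le_nn; first exact: W.
  by apply/esym/W.
move=> nr nr' /esym/eqP; rewrite eqn_mod_dvd; last first.
  by rewrite leq_pmul2l ?leq_exp2l//; case: u cu.
rewrite -mulnBr -(subnKC le_nn) expnD -{2}[(2 ^ n)%N]muln1 -mulnBr mulnA.
rewrite Gauss_dvdr; last first.
  by rewrite coprimeXl// coprimeMr cu coprimeXr.
move/dvdn_pow3_exp2; have [->|d0] := posnP (n' - n); first by rewrite addn0.
by move/(dvdn_leq d0); lia.
Qed.

(** * Exponential sums along powers of 2 *)

Section CosineProducts.
Local Open Scope ring_scope.
Context {R : realType}.
Implicit Types (t x y : R).

Lemma cosD2pin x (k : nat) : cos (x + 2 * pi * k%:R) = cos x.
Proof. by rewrite mulr_natr mulr_natl (periodicn (@cosD2pi R)). Qed.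

(** Doubling [2 * pi / 3] negates it modulo [2 * pi], so its cosine is a root of
    [2 * c ^ 2 - c - 1]; the positive sine excludes the root 1. *)
Lemma cos_2pi3 : cos (2 * pi / 3 : R) = - (1 / 2).
Proof.
set a := 2 * pi / 3; have pi0 := pi_gt0 R.
have s0 : 0 < sin a by apply: sin_gt0_pi; rewrite /a; lra.
have : cos (a *+ 2) = cos a.
  rewrite -[RHS]cosN -(cosD2pin (- a) 1); congr cos; rewrite /a; by field.
rewrite cos_mulr2n => c2; have := sin2cos2 a => sc.
have : (cos a + 1 / 2) * (cos a - 1) = 0 by lra.
by move/eqP; rewrite mulf_eq0 => /orP[|] /eqP; nra.
Qed.

(** Two of the three numbers have the same sign, so the absolute values add up to twice that of the
    third. *)
Lemma norm_sum3_le x y (z : R) : x + y + z = 0 ->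
  `|x| <= 1 -> `|y| <= 1 -> `|z| <= 1 -> `|x| + `|y| + `|z| <= 2.
Proof. by case: (ger0P x); case: (ger0P y); case: (ger0P z); lra. Qed.

Lemma sum3_norm_cos_le2 x :
  `|cos x| + `|cos (x + 2 * pi / 3)| + `|cos (x + 4 * pi / 3)| <= 2.
Proof.
apply: norm_sum3_le; rewrite ?cos_max//.
rewrite !cosD; have -> : 4 * pi / 3 = (2 * pi / 3) *+ 2 :> R by field.
by rewrite sin_mulr2n cos_mulr2n cos_2pi3; field.
Qed.

(** The modulus of the Fourier transform, at frequency [t], of the uniform measure on the centres of
    the Cantor intervals of level [m]. *)
Definition cosprod m t : R := \prod_(j < m) `|cos (2 * pi * t / 3 ^+ j.+1)|.

Lemma cosprod_ge0 m t : 0 <= cosprod m t.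
Proof. by apply: prodr_ge0. Qed.

Lemma cosprod_le1 m t : cosprod m t <= 1.
Proof. by apply: Num.Theory.prodr_ile1 => j _; rewrite normr_ge0 cos_max. Qed.

Lemma cosprodN m t : cosprod m (- t) = cosprod m t.
Proof. by apply: eq_bigr => j _; rewrite mulrN mulNr cosN. Qed.

Lemma cosprodS m t :
  cosprod m.+1 t = cosprod m t * `|cos (2 * pi * t / 3 ^+ m.+1)|.
Proof. by rewrite /cosprod big_ord_recr. Qed.

(** A factor [3 ^ v] in the frequency only costs the first [v] factors of the product, which are
    bounded by 1. *)
Lemma cosprodM3 v m t : cosprod (v + m) (3 ^+ v * t) <= cosprod m t.
Proof.
rewrite /cosprod big_split_ord /= -[leRHS]mul1r ler_pM//.
- by apply: prodr_ge0.
- by apply: prodr_ge0.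
- by apply: Num.Theory.prodr_ile1 => j _; rewrite normr_ge0 cos_max.
apply: ler_prod => j _; rewrite normr_ge0 -addnS exprD /=.
have -> : 2 * pi * (3 ^+ v * t) / (3 ^+ v * 3 ^+ j.+1) =
  2 * pi * t / 3 ^+ j.+1 by field; rewrite !expf_neq0.
by [].
Qed.

Lemma cosprod_leS m k t : cosprod (m + k) t <= cosprod m t.
Proof.
elim: k => [|k IH]; first by rewrite addn0.
rewrite addnS cosprodS (le_trans _ IH)// ler_piMr// ?cosprod_ge0//.
exact: cos_max.
Qed.

Lemma cosprod_period r t (d : nat) : cosprod r (t + 3 ^+ r * d%:R) = cosprod r t.
Proof.
apply: eq_bigr => j _; congr (`| _ |).
rewrite -(cosD2pin (2 * pi * t / 3 ^+ j.+1) (3 ^ (r - j.+1) * d)); congr cos.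
have -> : (3 : R) ^+ r = 3 ^+ (r - j.+1) * 3 ^+ j.+1 by rewrite -exprD subnK.
by rewrite natrM natrX; field; rewrite expf_neq0.
Qed.

Lemma sum_nat_mul3 (f : nat -> R) n :
  \sum_(0 <= i < n * 3) f i
  = \sum_(0 <= i < n) (f i + f (i + n)%N + f (i + n * 2)%N).
Proof.
rewrite (@big_cat_nat _ _ _ n)//=; last by lia.
rewrite (@big_cat_nat _ _ _ (n * 2) n)//=; [|lia..].
rewrite !big_split/= -addrA; congr (_ + (_ + _)).
  rewrite -[X in \sum_(X <= _ < _) _]add0n big_addn.
  by rewrite (_ : n * 2 - n = n)%N; last lia.
rewrite -[X in \sum_(X <= _ < _) _]add0n big_addn.
by rewrite (_ : n * 3 - n * 2 = n)%N; last lia.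
Qed.

(** The three lifts of a residue modulo [3 ^ r] share their first [r] factors, and their last
    factors are at angles [2 * pi / 3] apart; so each level multiplies the sum by at most 2, not
    3. *)
Lemma sum_cosprod_le r : \sum_(0 <= a < 3 ^ r) cosprod r a%:R <= 2 ^+ r.
Proof.
elim: r => [|r IH].
  by rewrite big_nat1 /cosprod big_ord0.
rewrite expnSr sum_nat_mul3 exprSr.
apply: (@le_trans _ _ ((\sum_(0 <= a < 3 ^ r) cosprod r a%:R) * 2)); last first.
  by rewrite ler_pM2r.
rewrite big_distrl /=; apply: ler_sum => a _.
rewrite !cosprodS !natrD natrM natrX.
have -> : cosprod r (a%:R + 3 ^+ r) = cosprod r a%:R.
  by rewrite -(cosprod_period r a%:R 1) mulr1.
rewrite cosprod_period -!mulrDr ler_wpM2l ?cosprod_ge0//.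
rewrite (le_trans _ (sum3_norm_cos_le2 (2 * pi * a%:R / 3 ^+ r.+1)))//.
rewrite le_eqVlt; apply/orP; left; apply/eqP.
by congr (_ + `|cos _| + `|cos _|); rewrite exprS; field; rewrite expf_neq0.

Qed.
End CosineProducts.

Section ExponentialSums.
Local Open Scope ring_scope.
Context {R : realType}.

Lemma ler_sum_inj (I J : finType) (h : I -> J) (g : J -> R) :
  injective h -> (forall j, 0 <= g j) -> \sum_i g (h i) <= \sum_j g j.
Proof.
move=> hI g0; rewrite -(@big_imset _ _ _ _ _ _ predT) /=; last exact: in2W.
rewrite [leRHS](bigID (mem (h @: predT))) /= lerDl; exact: sumr_ge0.
Qed.

Lemma sum_cosprod_pow2 (t r m : nat) : (0 < t)%N -> (t + r < m)%N ->
  \sum_(n < 2 * 3 ^ r) cosprod m ((t * 2 ^ n)%:R : R) <= 2 ^+ r.+1.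
Proof.
move=> t0 trm; have [u cu tE] := pfactor_coprime (isT : prime 3) t0.
set v := logn 3 t in tE.
(* This leaves room in [m] for the [v] factors lost to the 3-part of [t] and for the [r.+1] factors
   of a full period. *)
have vt : (v < t)%N.
  rewrite (leq_trans (ltn_expl v (isT : 1 < 3)%N))// tE leq_pmull//.
  by case: u cu tE t0 => // _ ->.
have q0 : (0 < 3 ^ r.+1)%N by rewrite expn_gt0.
pose h (n : 'I_(2 * 3 ^ r)) : 'I_(3 ^ r.+1) := Ordinal (ltn_pmod (u * 2 ^ n) q0).
have hI : injective h.
  by move=> n n' [] /pow2_mod3_inj E; apply/val_inj/E.
rewrite (le_trans _ (sum_cosprod_le r.+1))// big_mkord.
apply: (le_trans _ (ler_sum_inj hI (fun j : 'I__ => cosprod_ge0 r.+1 j%:R))).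
apply: ler_sum => n _.
have -> : m = (v + (r.+1 + (m - v - r.+1)))%N by lia.
rewrite tE (mulnC u) -mulnA natrM natrX (le_trans (cosprodM3 _ _ _))//.
rewrite (le_trans (cosprod_leS _ _ _))// /h /=.
rewrite [in leLHS](divn_eq (u * 2 ^ n) (3 ^ r.+1)) natrD addrC natrM.
by rewrite (mulrC (_ %/ _)%:R) natrX cosprod_period.
Qed.

Lemma cosprod_int m (z : int) : cosprod m (z%:~R : R) = cosprod m `|z|%N%:R.
Proof.
rewrite -[RHS]/(cosprod m (`|z|%N%:Z%:~R)).
by case: (intP z) => [|n|n] //; rewrite abszN mulrNz cosprodN.
Qed.

Lemma sum_cosprod_pow2z (t : int) (r m : nat) : t != 0 -> (`|t| + r < m)%N ->
  \sum_(n < 2 * 3 ^ r) cosprod m ((t * 2 ^+ n)%:~R : R) <= 2 ^+ r.+1.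
Proof.
move=> t0 trm; rewrite -absz_gt0 in t0.
rewrite (le_trans _ (sum_cosprod_pow2 t0 trm))//; apply: ler_sum => n _.
by rewrite cosprod_int abszM abszX.
Qed.

Lemma sum_shift_le (f : nat -> R) n N : (forall i, 0 <= f i) ->
  \sum_(i < N | (n <= i)%N) f i <= \sum_(d < N) f (n + d)%N.
Proof.
move=> f0; rewrite -(big_geq_mkord n N predT f) -{1}[n]add0n big_addn.
rewrite -(big_mkord predT (fun d => f (n + d)%N)).
rewrite [leRHS](@big_cat_nat _ _ _ (N - n))//=; last exact: leq_subr.
under eq_bigr do rewrite addnC.
by rewrite lerDl; apply: sumr_ge0.
Qed.

(** The two closed triangles cover the square. Each is summed along its diagonals, which are
    prolonged beyond the square to a common length [N]. *)
Lemma sum_square_le (G : nat -> nat -> R) N : (forall i j, 0 <= G i j) ->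
  \sum_(i < N) \sum_(j < N) G i j <=
  \sum_(d < N) \sum_(i < N) G i (i + d)%N + \sum_(d < N) \sum_(j < N) G (j + d)%N j.
Proof.
move=> G0; rewrite [X in _ <= X + _]exchange_big [X in _ <= _ + X]exchange_big /=.
apply: (@le_trans _ _ (\sum_(i < N) \sum_(j < N | (i <= j)%N) G i j +
                       \sum_(j < N) \sum_(i < N | (j <= i)%N) G i j)); last first.
  rewrite lerD//; apply: ler_sum => i _; first exact: (sum_shift_le i N (G0 i)).
  exact: (sum_shift_le i N (fun j => G0 j i)).
rewrite [X in _ <= _ + X](exchange_big_dep predT)//= -big_split /=.
apply: ler_sum => i _; rewrite (bigID (fun j : 'I_N => (i <= j)%N)) /= lerD2l.
rewrite [leRHS](bigID (fun j : 'I_N => ~~ (i <= j)%N)) /=.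
rewrite [X in X <= _](eq_bigl (fun j : 'I_N => (j <= i)%N && ~~ (i <= j)%N)).
  by rewrite lerDl; apply: sumr_ge0.
by move=> j; rewrite -ltnNge; case: ltnP => [/ltnW ->|]; rewrite ?andbF.
Qed.

(* [k * 2 ^ d + l] vanishes for at most one [d]; for all other [d] the
   single-frequency bound applies. *)
Lemma sum_cosprod_diag (k l : int) (r m : nat) (N := (2 * 3 ^ r)%N) :
  k != 0 -> ((`|k| + `|l|) * 2 ^ (2 * N) + r < m)%N ->
  \sum_(d < N) \sum_(i < N)
     cosprod m ((k * 2 ^+ (N + (i + d)) + l * 2 ^+ (N + i))%:~R : R)
  <= N%:R * (2 ^+ r.+1 + 1).
Proof.
move=> k0 kl_m; pose t d : int := (k * 2 ^+ d + l) * 2 ^+ N.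
have tE (d i : nat) :
    k * 2 ^+ (N + (i + d)) + l * 2 ^+ (N + i) = t d * 2 ^+ i :> int.
  by rewrite /t !exprD; ring.
have t_inj (d d' : nat) : t d = 0 -> t d' = 0 -> d = d'.
  rewrite /t => /eqP; rewrite mulf_eq0 expf_eq0 /= andbF orbF addr_eq0 => /eqP Ed.
  move=> /eqP; rewrite mulf_eq0 expf_eq0 /= andbF orbF addr_eq0 => /eqP Ed'.
  have /mulfI/(_ _ _ (etrans Ed (esym Ed'))) := k0.
  by rewrite -!natrX => /eqP; rewrite eqr_nat eqn_exp2l// => /eqP.
have t_bd (d : 'I_N) : (`|t d| + r < m)%N.
  apply: leq_ltn_trans kl_m; rewrite leq_add2r /t abszM !abszX mul2n -addnn expnD.
  rewrite mulnA leq_mul2r; apply/orP; right.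
  have : (`|(k * 2 ^+ d)%R| <= `|k| * 2 ^ N)%N.
    by rewrite abszM abszX leq_mul2l leq_exp2l// ltnW ?orbT.
  have : (0 < 2 ^ N)%N by rewrite expn_gt0.
  move: (k * 2 ^+ d) => x; nia.
have B0 : (0 : R) <= 2 ^+ r.+1 by rewrite exprn_ge0.
have inner (d : 'I_N) : \sum_(i < N)
     cosprod m ((k * 2 ^+ (N + (i + d)) + l * 2 ^+ (N + i))%:~R : R)
     <= 2 ^+ r.+1 + N%:R * (t d == 0)%:R.
  under eq_bigr do rewrite tE.
  have [t0|t0] := eqVneq (t d) 0; last first.
    by rewrite mulr0 addr0; apply: sum_cosprod_pow2z.
  rewrite mulr1 ler_wpDl//.
  apply: (le_trans (ler_sum _ (fun i _ => cosprod_le1 _ _))).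
  by rewrite sumr_const card_ord.
rewrite (le_trans (ler_sum _ (fun d _ => inner d)))// big_split /=.
rewrite sumr_const card_ord -mulr_sumr -[X in X + _]mulr_natl mulrDr lerD2l ler_wpM2l//.
have [d0 /eqP t0|tN0] := pickP (fun d : 'I_N => t d == 0).
  rewrite (bigD1 d0)//= t0 eqxx big1 ?addr0// => d dd0.
  by case: eqP => // td; case/eqP: dd0; apply/val_inj/t_inj.
by rewrite big1// => d _; rewrite tN0.
Qed.

Lemma sum_cosprod_pair (k l : int) (r m : nat) (N := (2 * 3 ^ r)%N) :
  k != 0 -> l != 0 -> ((`|k| + `|l|) * 2 ^ (2 * N) + r < m)%N ->
  \sum_(i < N) \sum_(j < N)
     cosprod m ((k * 2 ^+ (N + i) + l * 2 ^+ (N + j))%:~R : R)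
  <= 2 * (N%:R * (2 ^+ r.+1 + 1)).
Proof.
move=> k0 l0 klm.
rewrite (le_trans (sum_square_le (G := fun i j : nat =>
   cosprod m ((k * 2 ^+ (N + i) + l * 2 ^+ (N + j))%:~R : R)) _ _))//.
  by move=> i j; apply: cosprod_ge0.
rewrite mulr_natl mulr2n lerD ?sum_cosprod_diag//.
under eq_bigr do under eq_bigr do rewrite addrC.
by rewrite sum_cosprod_diag// (addnC `|l|%N).
Qed.
End ExponentialSums.

(** * Second moments over Cantor intervals *)

Section CantorAverages.
Local Open Scope ring_scope.
Context {R : realType}.
Implicit Types (x y a xi : R).

Lemma cosD_mul x y : cos (x + y) + cos (x - y) = 2 * cos x * cos y.
Proof. by rewrite cosD cosB; ring. Qed.

Fixpoint cantor_centers n : seq R :=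
  if n is m.+1 then
    [seq p / 3 | p <- cantor_centers m] ++ [seq (p + 2) / 3 | p <- cantor_centers m]
  else [:: 1 / 2].

Lemma cantor_stage_centers n x : cantor_stage n x ->
  exists2 p, p \in cantor_centers n & `|x - p| <= (2 * 3 ^+ n)^-1.
Proof.
elim: n x => [|n IH] x.
  rewrite /= in_itv /= => x01; exists (1 / 2); first by rewrite mem_seq1.
  by rewrite expr0 ler_norml; lra.
have p3 : (0 : R) < 3 ^+ n by rewrite exprn_gt0.
case=> -[y /IH [p pin ple] <-]; [exists (p / 3)|exists ((p + 2) / 3)].
- by rewrite /= mem_cat (map_f (fun p => p / 3)).
- rewrite -mulrBl normrM (ger0_norm (_ : 0 <= 3^-1))// exprS mulrCA invfM.
  by rewrite mulrC ler_wpM2l.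
- by rewrite /= mem_cat orbC (map_f (fun p => (p + 2) / 3)).
- rewrite -mulrBl (_ : y + 2 - (p + 2) = y - p); last by ring.
  rewrite normrM (ger0_norm (_ : 0 <= 3^-1))// exprS mulrCA invfM.
  by rewrite mulrC ler_wpM2l.
Qed.

(** The two contractions give copies of the sum at frequency [xi / 3] whose phases lie symmetrically
    about [a + pi * xi]; adding the cosines produces one more factor of the product. *)
Lemma sum_cos_centers n a xi :
  \sum_(p <- cantor_centers n) cos (a + 2 * pi * xi * p)
  = 2 ^+ n * cos (a + pi * xi) * \prod_(j < n) cos (2 * pi * xi / 3 ^+ j.+1).
Proof.
elim: n a xi => [|n IH] a xi.
  rewrite big_seq1 big_ord0 expr0 mulr1 [RHS]mul1r; congr cos; by field.
rewrite /= big_cat /= !big_map big_ord_recl.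
have E1 : \sum_(p <- cantor_centers n) cos (a + 2 * pi * xi * (p / 3)) =
    \sum_(p <- cantor_centers n) cos (a + 2 * pi * (xi / 3) * p).
  by apply: eq_bigr => p _; congr cos; field.
have E2 : \sum_(p <- cantor_centers n) cos (a + 2 * pi * xi * ((p + 2) / 3)) =
    \sum_(p <- cantor_centers n) cos ((a + 4 * pi * xi / 3) + 2 * pi * (xi / 3) * p).
  by apply: eq_bigr => p _; congr cos; field.
rewrite E1 E2 !IH -mulrDl -mulrDr.
rewrite (_ : a + pi * (xi / 3) = a + pi * xi - 2 * pi * xi / 3); last by field.
rewrite (_ : a + 4 * pi * xi / 3 + pi * (xi / 3) =
  a + pi * xi + 2 * pi * xi / 3); last by field.
rewrite (addrC (cos _)) cosD_mul expr1 exprS.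
rewrite (eq_bigr (fun i : 'I_n => cos (2 * pi * xi / 3 ^+ (bump 0 i).+1))).
  by ring.
move=> i _; congr cos; rewrite /bump /= add1n [in RHS]exprS; field.
by rewrite expf_neq0.
Qed.

Lemma sum_cos_centers_le n a xi :
  \sum_(p <- cantor_centers n) cos (a + 2 * pi * xi * p) <= 2 ^+ n * cosprod n xi.
Proof.
rewrite sum_cos_centers; apply: le_trans (ler_norm _) _.
rewrite !normrM normr_prod ger0_norm ?exprn_ge0// -mulrA ler_wpM2l ?exprn_ge0//.
by rewrite ler_piMl ?cos_max// prodr_ge0.
Qed.

(** Products of cosines turn into cosines at sum and difference frequencies, and each of these is
    summed over the centres separately. *)
Lemma second_moment_le (I : finType) (c a xi : I -> R) m :
  (forall i, 0 <= c i) ->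
  \sum_(p <- cantor_centers m) (\sum_i c i * cos (a i + 2 * pi * xi i * p)) ^+ 2
  <= 2 ^+ m * \sum_i \sum_j c i * c j *
       ((cosprod m (xi i + xi j) + cosprod m (xi i - xi j)) / 2).
Proof.
move=> c0.
have E p : (\sum_i c i * cos (a i + 2 * pi * xi i * p)) ^+ 2 =
    \sum_i \sum_j c i * c j / 2 *
      (cos ((a i + a j) + 2 * pi * (xi i + xi j) * p)
       + cos ((a i - a j) + 2 * pi * (xi i - xi j) * p)).
  rewrite expr2 big_distrlr; apply: eq_bigr => i _; apply: eq_bigr => j _.
  rewrite (_ : a i + a j + 2 * pi * (xi i + xi j) * p =
    (a i + 2 * pi * xi i * p) + (a j + 2 * pi * xi j * p)); last by ring.
  rewrite (_ : a i - a j + 2 * pi * (xi i - xi j) * p =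
    (a i + 2 * pi * xi i * p) - (a j + 2 * pi * xi j * p)); last by ring.
  by rewrite cosD_mul /=; field.
under eq_bigr do rewrite E.
rewrite exchange_big mulr_sumr; apply: ler_sum => i _ /=.
rewrite exchange_big mulr_sumr; apply: ler_sum => j _ /=.
rewrite -mulr_sumr big_split /=.
rewrite (_ : 2 ^+ m * _ = c i * c j / 2 *
  (2 ^+ m * cosprod m (xi i + xi j) + 2 ^+ m * cosprod m (xi i - xi j))).
  by rewrite ler_wpM2l ?lerD ?sum_cos_centers_le// divr_ge0// mulr_ge0.
by field.
Qed.
End CantorAverages.

(** * Even powers of the cosine: Fourier coefficients and mean *)

Section Kernel.
Local Open Scope ring_scope.
Context {R : realType}.
Implicit Types (x y z : R).

Lemma cosX n x : cos x ^+ n =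
  \sum_(j < n.+1) 'C(n, j)%:R / 2 ^+ n * cos ((n%:R - 2 * j%:R) * x).
Proof.
elim: n => [|n IH].
  by rewrite big_ord1 bin0 expr0 invr1 !mul1r mulr0 subr0 mul0r cos0.
pose f (j : nat) := cos ((n.+1%:R - 2 * j%:R) * x).
transitivity (\sum_(j < n.+1) 'C(n, j)%:R / 2 ^+ n.+1 * (f j + f j.+1)).
  rewrite exprS IH mulr_sumr; apply: eq_bigr => j _.
  have -> : f j = cos ((n%:R - 2 * j%:R) * x + x).
    by rewrite /f -natr1; congr cos; ring.
  have -> : f j.+1 = cos ((n%:R - 2 * j%:R) * x - x).
    by rewrite /f -!natr1; congr cos; ring.
  by rewrite cosD_mul exprS; field; rewrite expf_neq0.
rewrite [RHS]big_ord_recl /= bin0.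
under [X in _ = _ + X]eq_bigr do rewrite /bump leq0n add1n binS natrD 2!mulrDl.
rewrite big_split /= addrA; under eq_bigr do rewrite mulrDr.
rewrite big_split /=; congr (_ + _).
rewrite [LHS]big_ord_recl /= bin0; congr (_ + _).
by rewrite [RHS]big_ord_recr /= bin_small// !mul0r addr0.
Qed.

(** Induction through [M.+1 * 'C(2 * M + 2, M.+1) = 2 * (2 * M + 1) * 'C(2 * M, M)]. It keeps the
    mean of the kernel from being too small. *)
Lemma central_bin_ge M : (4 ^ M <= (2 * M).+1 * 'C(2 * M, M))%N.
Proof.
elim: M => [|M IH]; first by rewrite bin0.
have e1 := mul_bin_diag (2 * M).+2 M; have e2 := mul_bin_down (2 * M).+1 M.
rewrite /= in e1 e2; rewrite mulnS expnS.
have s1 : ((2 * M).+1 - M = M.+1)%N by lia.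
rewrite s1 in e2; rewrite !add2n; nia.
Qed.

(** The Fourier coefficients of [cos (pi z) ^ (2 M)]; the one at [j = M] is the constant term, hence
    the mean over a period. *)
Definition bin_weight M (j : nat) : R := 'C(2 * M, j)%:R / 4 ^+ M.

Lemma bin_weight_ge0 M j : 0 <= bin_weight M j.
Proof. by rewrite divr_ge0// exprn_ge0. Qed.

Lemma bin_weight_sum M : \sum_(j < (2 * M).+1) bin_weight M j = 1.
Proof.
rewrite -mulr_suml -natr_sum (_ : 4 = 2 ^+ 2 :> R); last by ring.
have -> : (\sum_(j < (2 * M).+1) 'C(2 * M, j) = 2 ^ (2 * M))%N.
  have := Pascal 1 1 (2 * M); rewrite addn1 => ->.
  by apply: eq_bigr => i _; rewrite !exp1n !muln1.
by rewrite -exprM natrX divff// expf_neq0.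
Qed.

Lemma bin_weight_mid M : ((2 * M).+1%:R)^-1 <= bin_weight M M.
Proof.
rewrite /bin_weight ler_pdivlMr ?exprn_gt0// mulrC ler_pdivrMr// mulrC.
by rewrite -natrX -natrM ler_nat central_bin_ge.
Qed.

Lemma cos_even_power M z : cos (pi * z) ^+ (2 * M) =
  \sum_(j < (2 * M).+1) bin_weight M j * cos (2 * pi * (M%:R - j%:R) * z).
Proof.
rewrite cosX; apply: eq_bigr => j _; congr (_ * cos _).
  by rewrite /bin_weight exprM (_ : 2 ^+ 2 = 4 :> R)//; ring.
by rewrite natrM; ring.
Qed.
End Kernel.

(** * Smallness of the kernel away from the integers *)

Section KernelOff.
Local Open Scope ring_scope.
Context {R : realType}.
Implicit Types (x y z : R).

Lemma norm_sinDpin x (k : nat) : `|sin (x + pi * k%:R)| = `|sin x|.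
Proof.
elim: k => [|k IH]; first by rewrite mulr0 addr0.
by rewrite -natr1 mulrDr mulr1 addrA sinDpi normrN.
Qed.

Lemma norm_sinDpiz x (k : int) : `|sin (x + pi * k%:~R)| = `|sin x|.
Proof.
case: (intP k) => [|n|n]; first by rewrite mulr0 addr0.
  exact: norm_sinDpin.
by rewrite -(norm_sinDpin _ n.+1) mulrNz mulrN addrNK.
Qed.

Lemma cos_pi3 : cos (pi / 3 : R) = 1 / 2.
Proof.
have := @cos_2pi3 R.
rewrite (_ : 2 * pi / 3 = pi - pi / 3); last by field.
by rewrite cosB cospi sinpi; lra.
Qed.

(** Mean value theorem: the cosine is at least 1/2 up to [pi / 3]. *)
Lemma sin_ge_half x : 0 <= x <= pi / 3 -> x / 2 <= sin x.
Proof.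
move=> /andP[x0 x3]; have p0 := pi_gt0 R.
have dsin y : y \in `]0, x[ -> is_derive y 1 (@sin R) (cos y).
  by move=> _; exact: is_derive_sin.
have csin : {within `[0, x]%classic, continuous (@sin R)}.
  by apply: continuous_subspaceT; exact: continuous_sin.
have [c] := MVT_segment x0 dsin csin.
rewrite in_itv /= => /andP[c0 cx]; rewrite sin0 !subr0 => ->.
rewrite mulrC ler_wpM2r//; have := cos_pi3; rewrite div1r => <-.
rewrite le_eqVlt; have [->|cp] := eqVneq c (pi / 3); first by rewrite eqxx.
by rewrite ltr_cos ?in_itv/= ?orbT//; (try (apply/orP; right)); lra.
Qed.

(** By periodicity and the symmetry [t -> 1 - t] one may take [z] in [[e, 1/2]]; there the sine is
    monotone and [sin (pi e) >= pi e / 2 >= e]. *)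
Lemma norm_sin_pi_ge z (e : R) : 0 < e <= 1 / 4 ->
  (forall p : int, e <= `|z - p%:~R|) -> e <= `|sin (pi * z)|.
Proof.
move=> /andP[e0 e4] far; have p0 := pi_gt0 R; have p2 := pi_ge2 R.
have /andP[f1 f2] := floor_itv z; set k := Num.floor z in f1 f2.
have far1 := far k; have far2 := far (k + 1).
move: far1 far2 f2; rewrite intrD; move: f1; set q : R := k%:~R => f1.
rewrite ger0_norm ?subr_ge0// => far1 far2 f2.
have {}far2 : e <= 1 - (z - q).
  by rewrite (le_trans far2)// ler0_norm; lra.
rewrite (_ : pi * z = pi * (z - q) + pi * q); last by ring.
rewrite norm_sinDpiz; move: (z - q) far1 far2 => t t1 t2 {f1 f2}.
wlog th : t t1 t2 / t <= 1 / 2.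
  move=> W; have [/W|th] := leP t (1 / 2); first exact.
  have := W (1 - t); rewrite mulrBr mulr1 sinB cospi sinpi mul0r sub0r mulN1r opprK.
  by apply; lra.
apply: le_trans (ler_norm _).
have : pi * e / 2 <= sin (pi * e) by apply: sin_ge_half; nra.
have : sin (pi * e) <= sin (pi * t).
  have [->//|et] := eqVneq e t.
  by apply/ltW; rewrite ltr_sin ?in_itv/=; nra.
by nra.
Qed.

Lemma bernoulli_ge x n : 0 <= x -> 1 + n%:R * x <= (1 + x) ^+ n.
Proof.
move=> x0; elim: n => [|n IH]; first by rewrite mul0r addr0 expr0.
have : (1 + x) * (1 + n%:R * x) <= (1 + x) ^+ n.+1.
  by rewrite exprS ler_wpM2l// addr_ge0.
apply: le_trans; rewrite -natr1.
have : 0 <= n%:R * x * x by rewrite !mulr_ge0.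
by lra.
Qed.

(** With [u = 1 / Q], Bernoulli gives [(1 + u) ^ Q >= 2], while [((1 - u) (1 + u)) ^ Q <= 1]. *)
Lemma one_sub_inv_pow_le (Q : nat) : (0 < Q)%N ->
  (1 - Q%:R^-1) ^+ Q <= 1 / 2 :> R.
Proof.
move=> Q0; have QR : (0 : R) < Q%:R by rewrite ltr0n.
set u : R := Q%:R^-1; have u0 : 0 < u by rewrite invr_gt0.
have u1 : u <= 1 by rewrite invf_le1// ler1n.
have := @bernoulli_ge u Q (ltW u0); rewrite mulfV ?gt_eqF// => b2.
have : ((1 - u) * (1 + u)) ^+ Q <= 1 by rewrite exprn_ile1//; nra.
rewrite exprMn; have : 0 <= (1 - u) ^+ Q by rewrite exprn_ge0// subr_ge0.
by nra.
Qed.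

(** [Q] is chosen so that the squared distance bound is [1 / Q]; then the squared cosine is at most
    [1 - 1 / Q], and its power [Q * Q] at most [2 ^ - Q]. As [Q >= 16], this is below
    [1 / (2 (2 M + 1))], hence below half the mean. *)
Lemma kernel_off (L : nat) (Q := (4 ^ (L + 2))%N) (M := (Q * Q)%N) z :
  (forall p : int, (4 * 2 ^+ L)^-1 <= `|z - p%:~R|) ->
  cos (pi * z) ^+ (2 * M) <= bin_weight M M / 2.
Proof.
move=> far; set e := (4 * 2 ^+ L)^-1 in far.
have Q16 : (16 <= Q)%N by rewrite /Q addn2 !expnS; have := expn_gt0 4 L; lia.
have e2 : e ^+ 2 = Q%:R^-1.
  rewrite /e /Q natrX exprVn exprMn -exprM (_ : 4 ^+ 2 = 2 ^+ 4)//; last by ring.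
  rewrite -exprD (_ : 4%:R = 2 ^+ 2 :> R); last by ring.
  by rewrite -exprM; congr (_ ^+ _)^-1; lia.
have e0 : 0 < e by rewrite invr_gt0 mulr_gt0// exprn_gt0.
have e4 : e <= 1 / 4.
  rewrite /e div1r lef_pV2 ?posrE ?mulr_gt0// ?exprn_gt0//.
  by rewrite ler_peMr// exprn_ege1//; lra.
have /norm_sin_pi_ge/(_ far) sge : 0 < e <= 1 / 4 by rewrite e0.
have c2 : cos (pi * z) ^+ 2 <= 1 - Q%:R^-1.
  rewrite cos2sin2 lerB// -e2 -(real_normK (num_real (sin _))).
  by rewrite ler_sqr ?nnegrE ?normr_ge0// ltW.
rewrite exprM (le_trans (lerXn2r M _ _ c2)) ?nnegrE ?sqr_ge0//.
  by rewrite (le_trans _ c2)// sqr_ge0.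
rewrite /M exprM (@le_trans _ _ ((1 / 2) ^+ Q))//.
  rewrite lerXn2r ?nnegrE//.
    by rewrite exprn_ge0// (le_trans _ c2)// sqr_ge0.
  by rewrite one_sub_inv_pow_le//; lia.
apply: (@le_trans _ _ (((2 * M).+1%:R)^-1 / 2)); last first.
  by rewrite ler_wpM2r// bin_weight_mid.
rewrite div1r exprVn -invfM lef_pV2 ?posrE ?mulr_gt0// ?exprn_gt0//.
rewrite -natrX -natrM ler_nat /M.
have : forall k, (16 <= k -> (2 * (k * k)).+1 * 2 <= 2 ^ k)%N.
  move=> k; rewrite leq_eqVlt => /orP[/eqP <-|]; first by [].
  elim: k => // k IH; rewrite ltnS leq_eqVlt => /orP[/eqP <-|k16]; first by [].
  by have := IH k16; rewrite expnS; nia.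
exact.
Qed.
End KernelOff.

(** * Chebyshev bound for the centres that miss a window *)

Section SecondMoment.
Local Open Scope ring_scope.
Context {R : realType}.
Implicit Types (x w : R).

Lemma sum_pairs (I J : finType) (g : I -> J -> I -> J -> R) :
  \sum_(u : I * J) \sum_(v : I * J) g u.1 u.2 v.1 v.2
  = \sum_j \sum_j' \sum_i \sum_i' g i j i' j'.
Proof.
rewrite -(pair_bigA _ (fun i j => \sum_v g i j v.1 v.2)) exchange_big /=.
apply: eq_bigr => j _; rewrite [RHS]exchange_big /=; apply: eq_bigr => i _.
by rewrite -(pair_bigA _ (g i j)) exchange_big.
Qed.

Definition kernel_sum (r M : nat) w x : R := \sum_(i < 2 * 3 ^ r)
  (cos (pi * (2 ^+ (2 * 3 ^ r + i) * x - w)) ^+ (2 * M) - bin_weight M M).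

(** Centring removes the zero frequency, so every remaining pair of frequencies obeys
    [sum_cosprod_pair]; the weights sum to at most 1, so the bound for one pair is the bound for
    all. *)
Lemma kernel_sum_second_moment r M w m (N := (2 * 3 ^ r)%N) :
  ((M + M) * 2 ^ (2 * N) + r < m)%N ->
  \sum_(p <- cantor_centers m) kernel_sum r M w p ^+ 2
  <= 2 ^+ m * (2 * (N%:R * (2 ^+ r.+1 + 1))).
Proof.
move=> Mm; pose J := 'I_(2 * M).+1.
pose k (j : J) : int := M%:Z - j%:Z.
pose c (j : J) : R := if k j == 0 then 0 else bin_weight M j.
pose xi (i : 'I_N) (j : J) : R := (k j * 2 ^+ (N + i))%:~R.
pose a (j : J) : R := - (2 * pi * (k j)%:~R * w).
have c0 j : 0 <= c j by rewrite /c; case: ifP => // _; exact: bin_weight_ge0.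
have SE x : kernel_sum r M w x =
    \sum_(u : 'I_N * J) c u.2 * cos (a u.2 + 2 * pi * xi u.1 u.2 * x).
  rewrite -(pair_bigA _ (fun i j => c j * cos (a j + 2 * pi * xi i j * x))) /=.
  apply: eq_bigr => i _; rewrite cos_even_power.
  have jM : (M < (2 * M).+1)%N by lia.
  have kM j : (k j == 0) = (j == Ordinal jM).
    by rewrite subr_eq0 eq_sym.
  rewrite (bigD1 (Ordinal jM)) //= subrr mulr0 mul0r cos0 mulr1 addrC addrK.
  rewrite [RHS](bigD1 (Ordinal jM)) //= {1}/c kM eqxx mul0r add0r.
  apply: eq_bigr => j jne; rewrite /c kM (negbTE jne); congr (_ * cos _).
  by rewrite /a /xi /k !rmorphM rmorphB rmorphXn /=; ring.
under eq_bigr do rewrite SE.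
rewrite (le_trans (second_moment_le _ _ _ _))//.
rewrite ler_wpM2l ?exprn_ge0//.
rewrite (sum_pairs (fun i j i' j' => c j * c j' *
  ((cosprod m (xi i j + xi i' j') + cosprod m (xi i j - xi i' j')) / 2))).
set T := 2 * _.
have c1 : \sum_j c j <= 1.
  rewrite -(bin_weight_sum M); apply: ler_sum => j _; rewrite /c.
  by case: ifP => // _; exact: bin_weight_ge0.
have T0 : 0 <= T by rewrite !mulr_ge0// addr_ge0// exprn_ge0.
apply: (@le_trans _ _ (\sum_j \sum_j' c j * c j' * T)); last first.
  under eq_bigr do rewrite -mulr_suml; rewrite -mulr_suml -big_distrlr /=.
  by rewrite ler_piMl// mulr_ile1// sumr_ge0.
apply: ler_sum => j _; apply: ler_sum => j' _.
under eq_bigr do rewrite -mulr_sumr; rewrite -mulr_sumr.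
rewrite {1 3}/c; case: eqP => [|/eqP kj]; first by rewrite !mul0r.
rewrite {1 2}/c; case: eqP => [|/eqP kj']; first by rewrite mulr0 !mul0r.
rewrite ler_wpM2l ?mulr_ge0 ?bin_weight_ge0//.
under eq_bigr do rewrite -mulr_suml; rewrite -mulr_suml ler_pdivrMr//.
under eq_bigr do rewrite big_split /=; rewrite big_split /= mulr_natr mulr2n.
have kle (i : J) : (`|k i| <= M)%N by rewrite /k; have := ltn_ord i; lia.
have bd : ((`|k j| + `|k j'|) * 2 ^ (2 * N) + r < m)%N.
  by apply: leq_ltn_trans Mm; rewrite leq_add2r leq_mul2r leq_add ?orbT.
rewrite lerD//.
  rewrite (le_trans _ (sum_cosprod_pair kj kj' bd))//.
  apply: ler_sum => i _; apply: ler_sum => i' _.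
  by rewrite /xi -rmorphD.
have kj'N : - k j' != 0 by rewrite oppr_eq0.
rewrite -(abszN (k j')) in bd; rewrite (le_trans _ (sum_cosprod_pair kj kj'N bd))//.
apply: ler_sum => i _; apply: ler_sum => i' _.
by rewrite /xi mulNr -rmorphB.
Qed.

Lemma markov_count (T : eqType) (s : seq T) (f : T -> R) (b : pred T) (v : R) :
  (forall y, 0 <= f y) -> (forall y, b y -> v <= f y) ->
  (count b s)%:R * v <= \sum_(y <- s) f y.
Proof.
move=> f0 bv; elim: s => [|y s IH]; first by rewrite mul0r big_nil.
rewrite big_cons /= natrD mulrDl lerD//.
by case: (boolP (b y)) => [/bv|_]; rewrite ?mul1r// mul0r.
Qed.

(** The factor 50 has to be small enough for [0.01 log2 n] to stay below [L + 1] when [n < 2 N], and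
    large enough for the saving [(3 / 2) ^ (50 L) >= 2 ^ (25 L)] to beat [M ^ 2], which is of order
    [2 ^ (8 L)]. *)
Definition window_depth L := (50 * L)%N.
Definition window_start L := (2 * 3 ^ window_depth L)%N.
Definition window_power L := (4 ^ (L + 2) * 4 ^ (L + 2))%N.

(** A consequence of missing the window, phrased through the kernel sum so that Chebyshev's
    inequality applies; [(2 * 2 ^ L)^-1] is the midpoint of the window. *)
Definition misses_window L : pred R := [pred x |
  kernel_sum (window_depth L) (window_power L) ((2 * 2 ^+ L)^-1) x
  <= - ((window_start L)%:R * (bin_weight (window_power L) (window_power L) / 2))].

Lemma misses_windowP L x :
  (forall (i : 'I_(window_start L)) (p : int),
    (4 * 2 ^+ L)^-1 <= `|2 ^+ (window_start L + i) * x - (2 * 2 ^+ L)^-1 - p%:~R|) ->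
  misses_window L x.
Proof.
move=> far; rewrite /misses_window inE /kernel_sum.
set b := bin_weight _ _.
apply: (@le_trans _ _ (\sum_(i < window_start L) - (b / 2))); last first.
  by rewrite sumr_const card_ord mulNrn mulr_natl.
apply: ler_sum => i _; have := kernel_off (far i).
by rewrite -/(window_power L) -/b; lra.
Qed.

Lemma count_misses_window L m :
  ((window_power L + window_power L) * 2 ^ (2 * window_start L)
     + window_depth L < m)%N ->
  (count (misses_window L) (cantor_centers m))%:R * 2 ^+ L <= 2 ^+ 24 * 2 ^+ m :> R.
Proof.
move=> Lm.
have := kernel_sum_second_moment ((2 * 2 ^+ L)^-1) Lm.
set K := kernel_sum _ _ _; set N := (2 * 3 ^ window_depth L)%N => SM.
set M := window_power L in Lm K SM *; set b := bin_weight M M : R.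
set r := window_depth L in Lm K N SM *.
have b0 : 0 < b by apply: lt_le_trans (bin_weight_mid _); rewrite invr_gt0.
have := @markov_count _ (cantor_centers m) (fun p => K p ^+ 2) (misses_window L)
  ((N%:R * (b / 2)) ^+ 2) (fun p => sqr_ge0 _).
set n : R := (count _ _)%:R => MC.
have {MC} : n * (N%:R * (b / 2)) ^+ 2 <= 2 ^+ m * (2 * (N%:R * (2 ^+ r.+1 + 1))).
  apply: le_trans SM; apply: MC => p; rewrite /misses_window inE -/K -/M -/b => Kp.
  have : 0 <= N%:R * (b / 2) by rewrite mulr_ge0// divr_ge0// ltW.
  by rewrite -[window_start L]/N in Kp *; nra.
have n0 : 0 <= n by [].
have b1 : 1 <= (2 * M).+1%:R * b.
  by rewrite -ler_pdivrMl// mulr1 bin_weight_mid.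
pose T : R := 3 ^+ r; pose A : R := 2 ^+ r; pose P : R := 2 ^+ m.
have NT : N%:R = 2 * T by rewrite /N natrM natrX.
have T0 : 0 < T by rewrite exprn_gt0.
have A1 : 1 <= A by rewrite exprn_ege1//; lra.
have P0 : 0 < P by rewrite exprn_gt0.
rewrite NT (exprS _ r) -/A -/P => H1.
(* The 12 comes from [4 * (2 * A + 1) <= 12 * A], as [A >= 1]. *)
have {}H1 : n * T * b ^+ 2 <= 12 * P * A.
  rewrite -(ler_pM2r T0).
  have -> : n * T * b ^+ 2 * T = n * (2 * T * (b / 2)) ^+ 2 by field.
  have : 0 <= P * T * (A - 1) by rewrite !mulr_ge0 ?subr_ge0// ltW.
  by move: H1; set X := n * _; lra.
pose D : R := 3 * M%:R.
have MD : (2 * M).+1%:R <= D.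
  by rewrite /D -natrM ler_nat /M /window_power; have := expn_gt0 4 (L + 2); nia.
have Db : 1 <= (D * b) ^+ 2.
  by rewrite exprn_ege1// (le_trans b1)// ler_wpM2r// ltW.
have {}H1 : n * T <= 12 * P * A * D ^+ 2.
  apply: (@le_trans _ _ (n * T * (D * b) ^+ 2)).
    by rewrite ler_peMr// mulr_ge0// ltW.
  rewrite exprMn (mulrC (D ^+ 2)) mulrA ler_wpM2r//.
  exact: sqr_ge0.
have ME : M%:R = 2 ^+ (4 * L + 8) :> R.
  rewrite /M /window_power -expnD natrX (_ : 4%:R = 2 ^+ 2 :> R); last by ring.
  by rewrite -exprM; congr (_ ^+ _); lia.
(* That is, [8 ^ (25 L) <= 9 ^ (25 L)]. *)
have AT : A * 2 ^+ (25 * L) <= T.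
  rewrite /A /T /r /window_depth -exprD (_ : 50 * L + 25 * L = 3 * (25 * L))%N; last by lia.
  rewrite (_ : 50 * L = 2 * (25 * L))%N; last by lia.
  by rewrite !exprM lerXn2r ?nnegrE ?exprn_ge0//; lra.
have LE k : (0 : R) < 2 ^+ k by rewrite exprn_gt0.
have A0 : 0 < A * 2 ^+ (8 * L) by rewrite mulr_gt0// ?LE// (lt_le_trans ltr01).
rewrite -(ler_pM2r A0) (@le_trans _ _ (n * T))//.
  rewrite -mulrA ler_wpM2l// (le_trans _ AT)// mulrCA ler_wpM2l ?(le_trans ler01)//.
  by rewrite -exprD ler_eXn2l ?ltr1n//; lia.
rewrite (le_trans H1)// /D ME exprMn -exprM (_ : (4 * L + 8) * 2 = 16 + 8 * L)%N; last by lia.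
(* The 16 stems from [M ^ 2 = 2 ^ (8 L + 16)]; the 8 absorbs [12 * 3 ^ 2 = 108]. *)
rewrite exprD (_ : 24 = 8 + 16)%N// (exprD _ 8 16).
have : 12 * 3 ^+ 2 <= (2 : R) ^+ 8 by lra.
have : 0 <= P * A * 2 ^+ 16 * 2 ^+ (8 * L).
  by rewrite !mulr_ge0 ?ltW// (lt_le_trans ltr01).
rewrite -/P; move: (2 ^+ 16) (2 ^+ (8 * L)) (2 ^+ 8) => u v w; nra.
Qed.
End SecondMoment.

(** * Hausdorff null sets *)

Section HausdorffNull.
Local Open Scope ring_scope.
Context {R : realType}.
Implicit Types (A B : set R) (d e s : R).

Lemma diam_ge0 (U : set R) : (0 <= diam U)%E.
Proof. by apply: ereal_sup_ubound; left. Qed.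

Lemma diam_le (U : set R) d : 0 <= d ->
  (forall x y, U x -> U y -> `|x - y| <= d) -> (diam U <= d%:E)%E.
Proof.
move=> d0 Ud; apply: ge_ereal_sup => _ [->|[x Ux [y Uy] <-]]; rewrite lee_fin//.
exact: Ud.
Qed.

(** Stated with explicit covers, so that subsets and countable unions are handled on the covers
    themselves. *)
Definition hausdorff_null s A := forall d e, 0 < d -> 0 < e ->
  exists2 U, is_cover d A U & (\sum_(0 <= i <oo) poweR (diam (U i)) s <= e%:E)%E.

Lemma hausdorff_null_measure s A :
  hausdorff_null s A -> hausdorff_measure s A = 0%E.
Proof.
move=> An.
have content_ge0 d : (0 <= hausdorff_content s d A)%E.
  apply: le_ereal_inf_tmp => _ [U _ <-].
  by apply: nneseries_ge0 => i _ _; exact: poweR_ge0.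
apply/eqP; rewrite eq_le; apply/andP; split; last first.
  apply: (le_trans (content_ge0 1)); apply: ereal_sup_ubound; by exists 1 => //; exact: ltr01.
apply: ge_ereal_sup => _ [d d0 <-]; apply/lee_addgt0Pr => e e0; rewrite add0e.
have [U Uc Ue] := An d e d0 e0.
by apply: le_trans Ue; apply: ereal_inf_lbound; exists U.
Qed.

Lemma hausdorff_nullS s A B : A `<=` B -> hausdorff_null s B -> hausdorff_null s A.
Proof.
move=> AB Bn d e d0 e0; have [U [BU Ud] Ue] := Bn d e d0 e0.
by exists U => //; split=> //; exact: subset_trans BU.
Qed.

Lemma hausdorff_null_bigcup s (A : nat -> set R) :
  (forall k, hausdorff_null s (A k)) -> hausdorff_null s (\bigcup_k A k).
Proof.
move=> An d e d0 e0.
have ek k : 0 < e / (2 ^ k.+1)%:R by rewrite divr_gt0// ltr0n expn_gt0.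
pose P k (U : nat -> set R) := is_cover d (A k) U /\
  (\sum_(0 <= i <oo) poweR (diam (U i)) s <= (e / (2 ^ k.+1)%:R)%:E)%E.
have [U UP] : {U : nat -> nat -> set R & forall k, P k (U k)}.
  apply: (@choice _ _ P) => k; have [V Vc Ve] := An k d _ d0 (ek k).
  by exists V.
(* The doubly indexed cover is enumerated along a bijection of [nat] with its square; the costs
   [e / 2 ^ k.+1] sum to [e]. *)
have /card_esym/ppcard_eqP[f] := card_nat2.
exists (fun i => U (f i).1 (f i).2).
  split=> [x [k _ Akx]|i]; last exact: ((UP (f i).1).1.2).
  have [j _ Ux] := (UP k).1.1 x Akx.
  by exists (f^-1%FUN (k, j)) => //; rewrite invK ?inE.
pose g (z : nat * nat) := poweR (diam (U z.1 z.2)) s.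
have g0 z : (0 <= g z)%E by exact: poweR_ge0.
rewrite nneseries_esumT//; last by move=> i; exact: g0.
rewrite -(@reindex_esum R _ _ setT setT f g)//=.
rewrite (_ : [set: nat * nat] = setT `*`` (fun=> setT)); last first.
  by apply/seteqP; split.
rewrite -(@esum_esum R _ _ setT (fun=> setT) (fun i j => g (i, j)))//.
rewrite -nneseries_esumT; last by move=> k /=; exact: esum_ge0.
apply: le_trans (epsilon_trick0 xpredT (ltW e0)).
apply: lee_nneseries => [k _ _|k _]; first exact: esum_ge0.
by rewrite -nneseries_esumT//; exact: (UP k).2.
Qed.

(** The default [set0] of [nth] pads a finite cover; since [s > 0], the padding costs nothing. *)
Lemma sum_seq_cover s (t : seq (set R)) d n : 0 < s -> 0 <= d -> size t = n ->
  (forall i, (diam (nth set0 t i) <= d%:E)%E) ->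
  (\sum_(0 <= i <oo) poweR (diam (nth set0 t i)) s <= (n%:R * d `^ s)%:E)%E.
Proof.
move=> s0 d0 tn td.
have g0 k : (0 <= poweR (diam (nth set0 t k)) s)%E by exact: poweR_ge0.
rewrite (nneseries_split 0 n) ?add0n => [|k _ //].
rewrite [X in (_ + X)%E]eseries0 => [|i ni _]; last first.
  rewrite nth_default ?tn// (_ : diam set0 = 0%E) ?poweR0r ?gt_eqF//.
  by apply/eqP; rewrite eq_le diam_ge0 diam_le// => x y [].
rewrite adde0.
apply: (@le_trans _ _ (\sum_(0 <= i < n) (d `^ s)%:E)%E).
  apply: lee_sum => i _; rewrite -poweR_EFin.
  apply: gt0_ler_poweR; first exact: ltW; last exact: td.
    by rewrite in_itv /= diam_ge0 leey.
  by rewrite in_itv /= lee_fin d0 leey.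
by rewrite sumEFin sumr_const_nat subn0 mulr_natl.
Qed.

Lemma hausdorff_null1 s x : 0 < s -> hausdorff_null s [set x].
Proof.
move=> s0 d e d0 e0.
have D i : (diam (nth set0 [:: [set x]] i) <= 0%:E)%E.
  apply: diam_le => // y z; case: i => [|i] /=; last by rewrite nth_nil.
  by move=> -> ->; rewrite subrr normr0.
exists (nth set0 [:: [set x]]).
  split=> [_ -> |i]; first by exists 0%N.
  by rewrite (le_trans (D i))// lee_fin ltW.
apply: (le_trans (@sum_seq_cover _ [:: [set x]] 0 1 s0 (lexx 0) erefl D)).
by rewrite powR0 ?gt_eqF// mulr0 lee_fin ltW.
Qed.
End HausdorffNull.

(** * Covers of the points that miss a window *)

Section MissedWindows.
Local Open Scope ring_scope.
Context {R : realType}.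

Definition missed_windows L : set R := [set x | forall (i : nat) (p : int),
  (i < window_start L)%N ->
  ~ (p%:~R <= 2 ^+ (window_start L + i) * x < p%:~R + (2 ^+ L)^-1)].

Lemma powR_cantor_dim m : (3 ^+ m)^-1 `^ (ln 2 / ln 3) = (2 ^+ m)^-1 :> R.
Proof.
have l3 : ln 3 != 0 :> R by rewrite gt_eqF// ln_gt0//; lra.
rewrite /powR invr_eq0 expf_eq0 pnatr_eq0 andbF -exprVn lnXn ?invr_gt0//.
rewrite lnV ?posrE// -[RHS]lnK ?posrE ?invr_gt0 ?exprn_gt0//.
rewrite -exprVn lnXn ?invr_gt0// lnV ?posrE//; congr expR.
by rewrite mulrnAr mulrN divfK.
Qed.

(** Passing from [x] to the centre [p] moves each shift by at most a quarter of the window's width.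
    A shift of [p] in the middle half would thus put that of [x] in the window. *)
Lemma misses_window_center L m (x p : R) :
  (2 * (2 * window_start L) + L < m)%N ->
  `|x - p| <= (2 * 3 ^+ m)^-1 -> missed_windows L x -> misses_window L p.
Proof.
move=> Lm xp missx; apply: misses_windowP => i q; rewrite leNgt; apply/negP => near.
apply: (missx i q (ltn_ord i)); move: near.
set N := window_start L in i Lm missx *; set n := (N + i)%N.
have : `|2 ^+ n * x - 2 ^+ n * p| <= (4 * 2 ^+ L)^-1.
  rewrite -mulrBr normrM ger0_norm ?exprn_ge0//.
  apply: (le_trans (ler_wpM2l _ xp)); first by rewrite exprn_ge0.
  have nm : (2 ^ n * (4 * 2 ^ L) <= 2 * 3 ^ m)%N.
    rewrite (_ : 2 ^ n * (4 * 2 ^ L) = 2 ^ (n + L + 2))%N; last first.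
      by rewrite !expnD; lia.
    have nLm : (n + L + 2 <= m)%N by rewrite /n; have := ltn_ord i; lia.
    rewrite (leq_trans (leq_pexp2l _ nLm))// (@leq_trans (3 ^ m))//; last exact: leq_pmull.
    by case: (m) => // m'; rewrite leq_exp2r.
  rewrite ler_pdivrMr ?mulr_gt0 ?exprn_gt0// mulrC ler_pdivlMr ?mulr_gt0 ?exprn_gt0//.
  by rewrite -!natrX -!natrM ler_nat.
have -> : (4 * 2 ^+ L)^-1 = (2 ^+ L)^-1 / 4 :> R by rewrite invfM mulrC.
have -> : (2 * 2 ^+ L)^-1 = (2 ^+ L)^-1 / 2 :> R by rewrite invfM mulrC.
rewrite !ler_norml !ltr_norml; lra.
Qed.

Lemma missed_windows_cover L (d : R) : 0 < d ->
  exists2 U, is_cover d (missed_windows L `&` cantor_set) U &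
    (\sum_(0 <= i <oo) poweR (diam (U i)) (ln 2 / ln 3) <=
      (2 ^+ 24 / 2 ^+ L)%:E)%E.
Proof.
move=> d0.
have [m0 m0d] : exists m0 : nat, d^-1 < m0%:R.
  by exists (Num.truncn d^-1).+1; exact: truncnS_gt.
pose b1 := ((window_power L + window_power L) * 2 ^ (2 * window_start L)
     + window_depth L)%N.
(* The three terms make the intervals shorter than [d], meet the threshold of the counting bound,
   and allow the passage to centres. *)
pose m := (m0 + b1 + (2 * (2 * window_start L) + L)).+1.
have md : (3 ^+ m)^-1 <= d.
  rewrite invf_ple ?posrE ?exprn_gt0// (le_trans (ltW m0d))//.
  rewrite -natrX ler_nat (leq_trans _ (ltnW (ltn_expl m (isT : 1 < 3)%N)))//.
  by rewrite /m; lia.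
pose ball3 (p : R) : set R := [set x | `|x - p| <= (2 * 3 ^+ m)^-1].
pose t := [seq ball3 p | p <- cantor_centers m & misses_window L p].
have d30 : 0 <= (3 ^+ m)^-1 :> R by rewrite invr_ge0 exprn_ge0.
have td i : (diam (nth set0 t i) <= ((3 ^+ m)^-1 : R)%:E)%E.
  apply: diam_le => // x y; have [it|it] := ltnP i (size t); last first.
    by rewrite nth_default.
  have [p _ ->] := mapP (mem_nth set0 it).
  rewrite /ball3 /= (_ : x - y = (x - p) - (y - p)); last by ring.
  move=> xp yp; apply: (le_trans (ler_normB _ _)).
  apply: (le_trans (lerD xp yp)); rewrite invfM.
  by rewrite -mulrDl (_ : 2^-1 + 2^-1 = 1 :> R) ?mul1r//; field.
exists (nth set0 t).
  split=> [x [mx Cx]|i]; last by rewrite (le_trans (td i))// lee_fin.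
  have [p pm xp] := cantor_stage_centers (Cx m I).
  have pt : ball3 p \in t.
    apply: map_f; rewrite mem_filter pm andbT.
    by apply: (misses_window_center _ xp mx); rewrite /m; lia.
  exists (index (ball3 p) t) => //.
  by rewrite nth_index.
have s0 : 0 < ln 2 / ln 3 :> R by rewrite divr_gt0// ln_gt0//; lra.
apply: (le_trans (sum_seq_cover s0 d30 (erefl (size t)) td)).
rewrite lee_fin powR_cantor_dim size_map size_filter.
rewrite ler_pdivrMr ?exprn_gt0// mulrAC ler_pdivlMr ?exprn_gt0//.
by apply: count_misses_window; rewrite /m -/b1; lia.
Qed.

(** The intersection lies in each single set with [L >= K], and the cost of covering that set is
    [O(2 ^ - L)]. *)
Lemma hausdorff_null_missed_windows K : hausdorff_null (ln 2 / ln 3 : R)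
  ((\bigcap_(L in [set L | (K <= L)%N]) missed_windows L) `&` cantor_set).
Proof.
move=> d e d0 e0.
have [n ne] : exists n : nat, 2 ^+ 24 / e < n%:R.
  by exists (Num.truncn (2 ^+ 24 / e)).+1; exact: truncnS_gt.
have [U [Uc Ud] Ue] := missed_windows_cover (K + n) d0.
exists U.
  split=> // x [mx Cx]; apply: Uc; split=> //; apply: mx; exact: leq_addr.
apply: (le_trans Ue); rewrite lee_fin ler_pdivrMr ?exprn_gt0// mulrC.
rewrite -ler_pdivrMr// (le_trans (ltW ne))// -natrX ler_nat.
by rewrite (leq_trans (ltnW (ltn_expl n (isT : 1 < 2)%N)))// leq_exp2l// leq_addl.
Qed.
End MissedWindows.

(** * Dyadic digits and the exceptional set *)

Section DyadicDigits.
Local Open Scope ring_scope.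
Context {R : realType}.
Implicit Types (x : R) (b : nat -> bool).

Definition dyadic_rationals : set R := \bigcup_q \bigcup_p [set p%:R / 2 ^+ q].

Definition dyadic_digit x n : bool := odd (Num.truncn (2 ^+ n.+1 * x)).

Lemma partial_dyadic_sum b n : exists B : nat, odd B = b n /\
  series (fun k => (b k)%:R / 2 ^+ k.+1 : R) n.+1 = B%:R / 2 ^+ n.+1.
Proof.
elim: n => [|n [B [_ E]]].
  by exists (b 0%N : nat); rewrite oddb /series /= big_nat1.
exists (b n.+1 + 2 * B)%N; split.
  by rewrite oddD oddM oddb addbF.
rewrite [LHS]/series /= big_nat_recr //= -/(series _ n.+1).
rewrite -[\sum_(0 <= k < n.+1) _]/(series (fun k => (b k)%:R / 2 ^+ k.+1) n.+1) E.
by rewrite natrD natrM (exprS 2 n.+1); field; rewrite expf_neq0.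
Qed.

Lemma dyadic_sum_tail b n k :
  series (fun k => (b k)%:R / 2 ^+ k.+1 : R) n <=
  series (fun k => (b k)%:R / 2 ^+ k.+1 : R) (n + k)%N <=
  series (fun k => (b k)%:R / 2 ^+ k.+1 : R) n + (2 ^+ n)^-1 - (2 ^+ (n + k))^-1.
Proof.
elim: k => [|k /andP[IH1 IH2]]; first by rewrite addn0 addrK lexx.
rewrite addnS /series /= big_nat_recr //=.
have p0 : (0 : R) < (2 ^+ (n + k).+1)^-1 by rewrite invr_gt0 exprn_gt0.
have E : (2 ^+ (n + k))^-1 = (2 ^+ (n + k).+1)^-1 + (2 ^+ (n + k).+1)^-1 :> R.
  by rewrite exprS; field; rewrite expf_neq0.
move: IH1 IH2; rewrite E /series /=.
by case: (b _); rewrite ?mul1r ?mul0r; move: p0; set u := (2 ^+ (n + k).+1)^-1; lra.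
Qed.

(** The partial sum [B / 2 ^ n.+1] and its successor enclose [x]; as [x] is not dyadic, the upper
    end is excluded, so [B] is the integer part of [2 ^ n.+1 * x] and its parity is the digit. *)
Lemma dyadic_expansion_digit x b : ~ dyadic_rationals x ->
  dyadic_expansion x b -> b = dyadic_digit x.
Proof.
move=> xD bx; apply/funext => n.
have [B [oB E]] := partial_dyadic_sum b n.
have lo : B%:R / 2 ^+ n.+1 <= x.
  rewrite -E; apply: (cvgr_to_ge bx); exists n.+1 => // k /= nk.
  rewrite -(subnKC nk); by have /andP[] := dyadic_sum_tail b n.+1 (k - n.+1).
have hi : x <= B.+1%:R / 2 ^+ n.+1.
  have -> : B.+1%:R / 2 ^+ n.+1 = B%:R / 2 ^+ n.+1 + (2 ^+ n.+1)^-1 :> R.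
    by rewrite -natr1 mulrDl mul1r.
  rewrite -E; apply: (cvgr_to_le bx); exists n.+1 => // k /= nk.
  rewrite -(subnKC nk); have /andP[_] := dyadic_sum_tail b n.+1 (k - n.+1).
  move=> h; apply: (le_trans h); rewrite gerBl invr_ge0 exprn_ge0//.
have xne : x != B.+1%:R / 2 ^+ n.+1.
  by apply/eqP => xE; apply: xD; exists n.+1 => //; exists B.+1.
rewrite /dyadic_digit (@truncn_def _ _ B) ?oB//.
rewrite mulrC -ler_pdivrMr ?exprn_gt0// lo /=.
by rewrite -ltr_pdivlMr ?exprn_gt0// lt_neqAle xne.
Qed.

(** The partial sums are the truncations of [2 ^ n * x] divided by [2 ^ n]. *)
Lemma dyadic_expansion_dyadic_digit x : 0 <= x < 1 ->
  dyadic_expansion x (dyadic_digit x).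
Proof.
move=> /andP[x0 x1].
pose fl n := Num.truncn (2 ^+ n * x).
have flE n : (fl n)%:R <= 2 ^+ n * x < (fl n).+1%:R.
  by apply: truncn_itv; rewrite mulr_ge0// exprn_ge0.
have flS n : fl n.+1 = (2 * fl n + odd (fl n.+1))%N.
  have /andP[a1 a2] := flE n; have /andP[c1 c2] := flE n.+1.
  have d1 : (2 * fl n < (fl n.+1).+1)%N.
    by rewrite -(ltr_nat R) natrM (le_lt_trans _ c2)// exprS -mulrA ler_pM2l.
  have d2 : (fl n.+1 < 2 * (fl n).+1)%N.
    by rewrite -(ltr_nat R) natrM (le_lt_trans c1)// exprS -mulrA ltr_pM2l.
  lia.
have sE n : series (fun k => (dyadic_digit x k)%:R / 2 ^+ k.+1 : R) n
    = (fl n)%:R / 2 ^+ n.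
  elim: n => [|n IH].
    rewrite /series /= big_geq// /fl expr0 mul1r (@truncn_def _ _ 0) ?mul0r//.
    by rewrite x0.
  rewrite [LHS]/series /= big_nat_recr //=.
  rewrite -[\sum_(0 <= k < n) _]/(series (fun k => (dyadic_digit x k)%:R / 2 ^+ k.+1) n).
  rewrite IH flS natrD natrM -/(dyadic_digit x n) exprS.
  by field; rewrite expf_neq0.
apply/cvgrPdist_le => e e0.
exists (Num.truncn e^-1).+1 => // n /= en; rewrite sE.
have /andP[a1 a2] := flE n; have p0 : (0 : R) < 2 ^+ n by rewrite exprn_gt0.
have -> : x = 2 ^+ n * x / 2 ^+ n by field; rewrite gt_eqF.
rewrite -mulrBl normrM ger0_norm ?subr_ge0// ger0_norm ?invr_ge0 ?(ltW p0)//.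
rewrite ler_pdivrMr// (@le_trans _ _ 1)//.
  by move: a2; rewrite -natr1; lra.
rewrite -ler_pdivrMl// mulr1 (le_trans (ltW (truncnS_gt _)))//.
by rewrite -natrX ler_nat (leq_trans en)// ltnW// ltn_expl.
Qed.

(** For [k < L], the number [2 ^ (n + k + 1) x] exceeds the even integer [2 ^ k.+1 * p] by less than
    1. *)
Lemma dyadic_digit_window x n L (p : int) : 0 <= x ->
  p%:~R <= 2 ^+ n * x < p%:~R + (2 ^+ L)^-1 ->
  forall k, (k < L)%N -> dyadic_digit x (n + k) = false.
Proof.
move=> x0 /andP[px xp] k kL.
have n0 : 0 <= 2 ^+ n * x by rewrite mulr_ge0// exprn_ge0.
have p0 : (0 <= p)%R.
  rewrite -ltzD1 -(ltr_int R) intrD (le_lt_trans n0)// (lt_le_trans xp)//.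
  by rewrite lerD2l invf_le1 ?exprn_gt0// exprn_ege1//; lra.
case: p p0 px xp => // p _ px xp; rewrite /dyadic_digit.
rewrite (@truncn_def _ _ (2 ^ k.+1 * p)); first by rewrite oddM oddX.
rewrite -addnS addnC exprD -mulrA -[(_ * p).+1%:R]natr1 natrM natrX ler_pM2l ?exprn_gt0// px /=.
have k0 : (0 : R) < 2 ^+ k.+1 by rewrite exprn_gt0.
rewrite (@lt_le_trans _ _ (2 ^+ k.+1 * (p%:R + (2 ^+ L)^-1)))//.
  by rewrite ltr_pM2l.
rewrite mulrDr lerD2l ler_pdivrMr ?exprn_gt0// mul1r.
by rewrite ler_eXn2l// ltr1n.
Qed.

Lemma run_length_le L n : (0 < n)%N -> (n < 2 * window_start L)%N ->
  run_length R n <= L%:Z.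
Proof.
move=> n0 nN; have l2 : 0 < ln 2 :> R by rewrite ln_gt0//; lra.
rewrite /run_length -ltzD1 floor_lt_int /log2.
rewrite mulrC ltr_pdivrMr// ltr_pdivrMr//.
(* [2 N = 4 * 3 ^ (50 L)] is at most [2 ^ (100 L + 2)]. *)
have nb : (n < 2 ^ (100 * L.+1))%N.
  apply: (leq_trans nN); rewrite /window_start /window_depth.
  apply: (@leq_trans (2 * (2 * 4 ^ (50 * L)))%N).
    by rewrite !leq_mul2l /=; case: (50 * L)%N => // k; rewrite leq_exp2r.
  by rewrite (_ : 4 = 2 ^ 2)%N// -expnM -!expnS leq_exp2l//; lia.
have : ln (n%:R : R) < ln (2 ^+ (100 * L.+1)).
  by rewrite ltr_ln ?posrE ?ltr0n ?exprn_gt0// -natrX ltr_nat.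
rewrite lnXn// -[ln 2 *+ _]mulr_natl natrM -[L.+1%:R]natr1 intrD => h; apply: (lt_le_trans h).
by rewrite le_eqVlt; apply/orP; left; apply/eqP; ring.
Qed.
End DyadicDigits.

(** * The exceptional set and the conclusion *)

Section BadSet.
Local Open Scope ring_scope.
Context {R : realType}.

(** An explicit Borel set, since an almost-everywhere statement asks for a measurable null superset.
    Dyadic rationals are included to have a unique expansion elsewhere; the complement of [[0, 1]]
    does not meet the Cantor set. *)
Definition bad_set : set (measurableTypeR R) :=
  ~` `[0, 1] `|` dyadic_rationals `|`
  \bigcup_K \bigcap_(L in [set L | (K <= L)%N]) missed_windows L.

Lemma measurable_missed_windows L :
  measurable (missed_windows L : set (measurableTypeR R)).
Proof.
pose n i := (window_start L + i)%N.
rewrite (_ : missed_windows L =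
  \bigcap_(i in [set i | (i < window_start L)%N]) ~` \bigcup_(p : int)
    `[p%:~R / 2 ^+ n i, (p%:~R + (2 ^+ L)^-1) / 2 ^+ n i[%classic).
  apply: bigcap_measurableType => i _; apply/measurableC.
  by apply: countable_bigcupT_measurable.
have n0 i : (0 : R) < 2 ^+ n i by rewrite exprn_gt0.
apply/seteqP; split=> [x mx i /= iN [p _]|x mx i p iN].
  rewrite /= in_itv /= ler_pdivrMr// ltr_pdivlMr// mulrC.
  exact: mx.
rewrite -/(n i) => xp; apply: (mx i iN); exists p => //=.
by rewrite in_itv /= ler_pdivrMr// ltr_pdivlMr// mulrC.
Qed.

Lemma measurable_bad_set : measurable bad_set.
Proof.
apply: measurableU; first apply: measurableU.
- by apply: measurableC; exact: measurable_itv.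
- by apply: bigcupT_measurable => q; apply: bigcupT_measurable => p.
- apply: bigcupT_measurable => K; apply: bigcap_measurableType => L _.
  exact: measurable_missed_windows.
Qed.

Lemma cantor_measure_bad_set : cantor_measure bad_set = 0%E.
Proof.
have s0 : 0 < ln 2 / ln 3 :> R by rewrite divr_gt0// ln_gt0//; lra.
apply: hausdorff_null_measure.
pose F k := if k is K.+1 then
  (\bigcap_(L in [set L | (K <= L)%N]) missed_windows L) `&` cantor_set
  else dyadic_rationals : set R.
apply: (@hausdorff_nullS _ _ _ (\bigcup_k F k)).
  move=> x [[[x01|xD]|[K _ xK]] xC]; last 2 first.
  - by exists 0%N.
  - by exists K.+1.
  by case: (x01 (xC 0%N I)).
apply: hausdorff_null_bigcup => -[|K]; last exact: hausdorff_null_missed_windows.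
apply: hausdorff_null_bigcup => q; apply: hausdorff_null_bigcup => p.
exact: hausdorff_null1.
Qed.

Lemma zero_run_off_bad_set x : ~ bad_set x ->
  exists a : nat -> bool, unique (dyadic_expansion x) a /\
    infinite_set [set n : nat | (0 < n)%N /\ zero_run_at R a n].
Proof.
move=> xB.
have x01 : 0 <= x <= 1.
  by apply: contrapT => h; apply: xB; left; left => /=; rewrite in_itv.
have xD : ~ dyadic_rationals x by move=> h; apply: xB; left; right.
have /andP[x0 x1] := x01.
have {}x1 : x < 1.
  rewrite lt_neqAle x1 andbT; apply/eqP => xE; apply: xD.
  by exists 0%N => //; exists 1%N => //=; rewrite xE expr0 divr1.
exists (dyadic_digit x); split.
  split; first by apply: dyadic_expansion_dyadic_digit; rewrite x0.
  by move=> b bx; rewrite (dyadic_expansion_digit xD bx).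
move=> /finite_seqP[s sE].
(* If the runs were finitely many, [K] would exceed all their positions; but a window hit with
   [L >= K] starts a run beyond [L]. *)
pose K := (\max_(i <- s) i).+1.
have [L [KL [i [p [iN xw]]]]] : exists L, (K <= L)%N /\ exists i (p : int),
    (i < window_start L)%N /\
    p%:~R <= 2 ^+ (window_start L + i) * x < p%:~R + (2 ^+ L)^-1.
  apply: contrapT => h; apply: xB; right; exists K => // L KL i p iN xw.
  by apply: h; exists L; split=> //; exists i, p.
have Ln : (L < window_start L + i)%N.
  rewrite ltn_addr// /window_start /window_depth.
  have : (50 * L < 3 ^ (50 * L))%N by exact: ltn_expl.
  lia.
have : [set` s] (window_start L + i)%N.
  rewrite -sE; split; first by lia.
  move=> k kr; apply: (dyadic_digit_window x0 xw).
  rewrite -ltz_nat (lt_le_trans kr)// run_length_le//; lia.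
move=> /= ins; have := @leq_bigmax_seq _ s xpredT id _ ins isT.
by rewrite -ltnS -/K; lia.
Qed.
End BadSet.

Theorem corollary1p7 (R : realType) :
  {ae cantor_measure (R := R), forall x : R,
    exists a : nat -> bool,
      unique (dyadic_expansion x) a /\
      infinite_set [set n : nat | (0 < n)%N /\ zero_run_at R a n]}.
Proof.
exists bad_set; split; first exact: measurable_bad_set.
  exact: cantor_measure_bad_set.
by move=> x; apply: contra_notP => /zero_run_off_bad_set.
Qed.
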